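(* Let $L,R:[0,\infty)\times\mathbb{R}\to\mathbb{R}$ satisfy: (i) for each $x\in\mathbb{R}$, $L(\cdot,x),R(\cdot,x)\in D[0,\infty)$; (ii) for each $t\ge 0$, $L(t,\cdot)$ and $R(t,\cdot)$ are strictly increasing; (iii) there are constants $0<c<C<\infty$ such that $c|x-y|\le |L(t,x)-L(t,y)|\le C|x-y|$ and $c|x-y|\le |R(t,x)-R(t,y)|\le C|x-y|$ for all $t\ge 0$, $x,y\in\mathbb{R}$; (iv) $\inf_{(t,x)\in[0,\infty)\times\mathbb{R}}(R(t,x)-L(t,x))>0$. Let $S\in D[0,\infty)$ and, for each $t\ge 0$, let $\Phi_t$ and $\Psi_t$ be the unique real numbers with $L(t,S_t+\Phi_t)=0$ and $R(t,S_t+\Psi_t)=0$. Set, for $t\ge 0$, $$K_t=-\max\left((-\Phi_0)^+\wedge \inf_{r\in[0,t]}(-\Psi_r),\ \sup_{s\in[0,t]}\left[(-\Phi_s)\wedge \inf_{r\in[s,t]}(-\Psi_r)\right] \right),$$ and $X=S+K$. Then $(X,K)$ is the unique solution of the Skorokhod problem $\mathbb{SP}_L^R(S)$.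
   Context: $D[0,\infty)$ is the set of real-valued right-continuous functions on $[0,\infty)$ with left limits; $BV[0,\infty)$ is the set of $K\in D[0,\infty)$ of bounded variation on each compact interval. Notation: $a\wedge b=\min(a,b)$, $a^+=\max(a,0)$. Skorokhod problem $\mathbb{SP}_L^R(S)$: a pair $(X,K)\in D[0,\infty)\times BV[0,\infty)$ is a solution if (a) $X_t=S_t+K_t$ for all $t\ge0$; (b) $L(t,X_t)\le 0\le R(t,X_t)$ for all $t\ge 0$; (c) $K_{0-}=0$ and $K=K^r-K^l$, where $K^r,K^l$ are nondecreasing (right-continuous, with $K^r_{0-}=K^l_{0-}=0$) and $\int_0^\infty I_{\{L(s,X_s)<0\}}dK^l_s=0$, $\int_0^\infty I_{\{R(s,X_s)>0\}}dK^r_s=0$. The integrals are over $[0,\infty)$ including time $0$, where $dK^r,dK^l$ have atoms of mass $K^r_0,K^l_0$. *)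

(* Defs.v *)
From HB Require Import structures.
From mathcomp Require Import all_boot all_order all_algebra.
From mathcomp Require Import all_classical all_reals all_analysis.

Set Implicit Arguments.
Unset Strict Implicit.
Unset Printing Implicit Defensive.

Import Order.TTheory GRing.Theory Num.Theory.
Import numFieldNormedType.Exports.

Local Open Scope classical_set_scope.
Local Open Scope ring_scope.

(* A function on [0, +oo) is represented by a total function on R whose values
   at negative times are irrelevant: every definition below only looks at
   nonnegative times, and uniqueness is equality at nonnegative times. *)

Section Skorokhod.
Context {R : realType}.
Implicit Types (f S X K Phi Psi : R -> R) (Lf Rf : R -> R -> R).

Definition cadlag f : Prop :=
  (forall t : R, 0 <= t -> f s @[s --> t^'+] --> f t) /\
  (forall t : R, 0 < t -> cvg (f s @[s --> t^'-])).

Definition cadlagBV f : Prop :=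
  cadlag f /\ forall a b : R, 0 <= a -> a <= b -> bounded_variation a b f.

(* [Kr] and [Kl] are nondecreasing right-continuous functions on the whole line
   that vanish at negative times. This encodes the convention "value 0 at 0-",
   and gives the Lebesgue-Stieltjes measures of [Kr] and [Kl] atoms of mass
   [Kr 0] and [Kl 0] at time 0. *)
Definition skorokhod_solution Lf Rf S X K : Prop :=
  [/\ cadlag X,
      cadlagBV K,
      forall t : R, 0 <= t -> X t = S t + K t,
      forall t : R, 0 <= t -> Lf t (X t) <= 0 <= Rf t (X t) &
      exists Kr Kl : cumulative R R,
        [/\ forall t : R, t < 0 -> Kr t = 0 /\ Kl t = 0,
            forall t : R, 0 <= t -> K t = Kr t - Kl t,
            (\int[lebesgue_stieltjes_measure Kl]_(s in `[0%R, +oo[)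
               (\1_[set u | (Lf u (X u) < 0)%R] s)%:E = 0)%E &
            (\int[lebesgue_stieltjes_measure Kr]_(s in `[0%R, +oo[)
               (\1_[set u | (0 < Rf u (X u))%R] s)%:E = 0)%E]].

Definition reflection_term Phi Psi (t : R) : R :=
  - Num.max
      (Num.min (Num.max (- Phi 0) 0) (inf [set - Psi r | r in `[0, t]]))
      (sup [set Num.min (- Phi s) (inf [set - Psi r | r in `[s, t]])
           | s in `[0, t]]).

End Skorokhod.

(* Main.v *)
Require Import Defs.
From HB Require Import structures.
From mathcomp Require Import all_boot all_order all_algebra.
From mathcomp Require Import all_classical all_reals all_analysis.
From mathcomp Require Import lra.

Set Implicit Arguments.
Unset Strict Implicit.
Unset Printing Implicit Defensive.

Import Order.TTheory GRing.Theory Num.Theory.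
Import numFieldNormedType.Exports.

Local Open Scope classical_set_scope.
Local Open Scope ring_scope.

(* Put h = - K, lo = - Phi and up = - Psi, extended to negative times by 0, - d
   and d, where d > 0 is a lower bound of the gap between the barriers. The
   explicit formula for K yields lo <= h <= up and two comparison principles: if
   h u <= m and lo <= m on [u, t], then h t <= m, and dually for up. A solution
   of the Skorokhod problem obeys the same principles, because while h > m >= lo
   the measure dKl does not charge and h = Kl - Kr cannot increase. Conversely,
   the comparison principles determine h and everything about it: near every
   time, on each side, lo and up are separated by a constant level, on which
   stretch h is monotone and follows a single barrier. Hence h has one-sided
   limits and bounded variation, the two halves of its Jordan decomposition only
   charge times at which h is on the relevant barrier, and two such functions
   that start together agree. *)

(** * Real induction, one-sided limits and variation of monotone functions *)

(** The infimum of the counterexamples satisfies [P] by the left step, and the right step then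
    contradicts that it is their infimum. This serves below wherever a local property has to be
    propagated along an interval. *)
Lemma real_induction (R : realType) (P : R -> Prop) (a : R) : P a ->
  (forall t, a <= t -> P t -> exists2 b, t < b & forall s, t < s < b -> P s) ->
  (forall t, a < t -> (forall s, a <= s < t -> P s) -> P t) ->
  forall t, a <= t -> P t.
Proof.
move=> Pa Pr Pl t at_; apply: contrapT => nPt.
pose A := [set s | a <= s /\ ~ P s].
have Ai : has_inf A by split; [exists t|exists a => s []].
have aA : a <= inf A by apply: lb_le_inf; [exists t|move=> s []].
have PA s : a <= s < inf A -> P s.
  move=> /andP[as_ sA]; apply: contrapT => nPs.
  by have := ge_inf Ai.2 (conj as_ nPs : A s); lra.
have PiA : P (inf A).
  by move: aA; rewrite le_eqVlt => /predU1P[<-//|aA]; apply: Pl.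
have [b Ab Pb] := Pr _ aA PiA.
have [|s [as_ nPs] sb] := @inf_adherent _ A (b - inf A) _ Ai; first lra.
have := ge_inf Ai.2 (conj as_ nPs : A s).
by rewrite le_eqVlt => /predU1P[sE|sA]; apply: nPs; [rewrite -sE|apply: Pb; lra].
Qed.

Section one_sided_limits.
Context {R : realType}.
Implicit Types (f : R -> R) (t l e : R).

Lemma at_right_dist_lt f t l : f s @[s --> t^'+] --> l ->
  forall e, 0 < e -> exists2 b, t < b & forall s, t < s < b -> `|f s - l| < e.
Proof.
move=> /cvgrPdist_lt fl e e0; have := fl _ e0.
rewrite near_withinE => -[d /= d0 H]; exists (t + d); first lra.
move=> s ts; rewrite distrC; apply: H; last by lra.
by rewrite /= ltr_norml; lra.
Qed.

Lemma at_left_dist_lt f t l : f s @[s --> t^'-] --> l ->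
  forall e, 0 < e -> exists2 a, a < t & forall s, a <= s < t -> `|f s - l| < e.
Proof.
move=> /cvgrPdist_lt fl e e0; have := fl _ e0.
(* Halving [d] keeps the left endpoint itself inside the neighbourhood, so the estimate holds at [a]
   too. *)
rewrite near_withinE => -[d /= d0 H]; exists (t - d / 2); first lra.
move=> s ts; rewrite distrC; apply: H; last by lra.
by rewrite /= ltr_norml; lra.
Qed.

Lemma dist_le_at_right f t l :
  (forall e, 0 < e -> exists2 b, t < b & forall s, t < s < b -> `|f s - l| <= e) ->
  f s @[s --> t^'+] --> l.
Proof.
move=> H; apply/cvgrPdist_le => e /H[b tb Hb].
near=> s; rewrite distrC; apply: Hb; apply/andP; split.
  by near: s; exact: nbhs_right_gt.
by near: s; exact: nbhs_right_lt.
Unshelve. all: by end_near. Qed.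

Lemma dist_le_at_left f t l :
  (forall e, 0 < e -> exists2 a, a < t & forall s, a < s < t -> `|f s - l| <= e) ->
  f s @[s --> t^'-] --> l.
Proof.
move=> H; apply/cvgrPdist_le => e /H[b tb Hb].
near=> s; rewrite distrC; apply: Hb; apply/andP; split.
  by near: s; exact: nbhs_left_gt.
by near: s; exact: nbhs_left_lt.
Unshelve. all: by end_near. Qed.

End one_sided_limits.

Lemma nondecreasing_left_cvg {R : realType} (f : R -> R) (a t m : R) : a < t ->
  (forall s, a <= s < t -> f s <= m) ->
  (forall r s, a <= r -> r <= s -> s < t -> f r <= f s) ->
  cvg (f s @[s --> t^'-]).
Proof.
move=> at_ fm ndf; apply: nondecreasing_at_left_is_cvgr; near=> b.
- have ab : a <= b by near: b; exact: nbhs_left_ge.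
  move=> r s; rewrite !in_itv/= => rb sb rs; apply: ndf => //; lra.
- have ab : a <= b by near: b; exact: nbhs_left_ge.
  by exists m => _ [s /= + <-]; rewrite in_itv/= => sb; apply: fm; lra.
Unshelve. all: by end_near. Qed.

(** On [[a, b]], [f] is a difference of nondecreasing functions: [A] lifts the value at [b] to [m],
    and [B] vanishes except for the correction [m - f b] at [b]. The bound adds their variations. *)
Lemma nondecreasing_jump_total_variation {R : realType} (f : R -> R) (a b m : R) :
  a < b -> (forall s, a <= s < b -> f s <= m) ->
  (forall s t, a <= s -> s <= t -> t < b -> f s <= f t) -> f b <= m ->
  (total_variation a b f <= (m - f a + (m - f b))%:E)%E.
Proof.
move=> ab fm ndf fb.
pose A s := if s == b then m else f s.
pose B s := if s == b then m - f b else 0.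
have AE s : s < b -> A s = f s by move=> sb; rewrite /A lt_eqF.
have BE s : s < b -> B s = 0 by move=> sb; rewrite /B lt_eqF.
have Ab : A b = m by rewrite /A eqxx.
have Bb : B b = m - f b by rewrite /B eqxx.
have ndA : {in `[a, b] &, nondecreasing_fun A}.
  move=> s t; rewrite !in_itv/= => /andP[as_ sb] /andP[at_].
  rewrite le_eqVlt => /predU1P[->|tb] st; rewrite ?Ab ?(AE t)//.
    move: sb; rewrite le_eqVlt => /predU1P[->|sb]; rewrite ?Ab ?AE//.
    by apply: fm; lra.
  by rewrite AE; [exact: ndf|lra].
have ndB : {in `[a, b] &, nondecreasing_fun B}.
  move=> s t; rewrite !in_itv/= => /andP[as_ sb] /andP[at_].
  rewrite le_eqVlt => /predU1P[->|tb] st; rewrite ?Bb ?(BE t)//.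
    move: sb; rewrite le_eqVlt => /predU1P[->|sb]; rewrite ?Bb ?BE//.
    by rewrite subr_ge0.
  by rewrite BE//; lra.
have -> : f = A \+ (\- B).
  by apply/funext => s; rewrite /A /B /=; case: eqP => [->|_]; lra.
apply: le_trans (total_variation_le _ _ (ltW ab)) _.
rewrite total_variationN (nondecreasing_total_variation (ltW ab) ndA).
rewrite (nondecreasing_total_variation (ltW ab) ndB).
by rewrite -EFinD lee_fin /= Ab Bb AE// BE//; lra.
Qed.

(** * Reflection between two barriers *)

(** Right-continuous with left limits on the whole line: paths are extended to negative times so
    that a jump at time 0 is treated like any other. *)
Definition regulated {R : realType} (f : R -> R) :=
  (forall t, f s @[s --> t^'+] --> f t) /\
  (forall t, cvg (f s @[s --> t^'-])).

Lemma regulatedN {R : realType} (f : R -> R) : regulated f -> regulated (\- f).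
Proof.
by move=> [fr fl]; split=> t; [exact: cvgN (fr t)|exact: is_cvgN (fl t)].
Qed.

(* The two comparison principles say that [h] is pushed up only while at [lo]
   and down only while at [up], without mentioning the pushing measures. *)
Definition reflected {R : realType} (lo up h : R -> R) :=
  [/\ forall t, lo t <= h t <= up t,
      forall u t m, u <= t -> h u <= m ->
        (forall s, u <= s <= t -> lo s <= m) -> h t <= m &
      forall u t m, u <= t -> m <= h u ->
        (forall s, u <= s <= t -> m <= up s) -> m <= h t].

(** Changing signs exchanges the barriers, so a statement about one of them yields its dual for the
    other. *)
Lemma reflectedN {R : realType} (lo up h : R -> R) :
  reflected lo up h -> reflected (\- up) (\- lo) (\- h).
Proof.
move=> [b P2 P3]; split=> [t|u t m ut /= hm H|u t m ut /= hm H] /=.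
- by have := b t; lra.
- by rewrite lerNl; apply: (P3 u) => //=; [lra|move=> s /H /=; lra].
- by rewrite lerNr; apply: (P2 u) => //=; [lra|move=> s /H /=; lra].
Qed.

Section reflected_theory.
Context {R : realType}.
Variables (d : R) (lo up : R -> R).
Hypotheses (d0 : 0 < d) (lo_up : forall t, lo t + d <= up t).
Hypotheses (reg_lo : regulated lo) (reg_up : regulated up).
Implicit Types (h : R -> R) (a b t m : R).

(** The interval is half-open since the barriers may jump at [b]. *)
Definition separated_on a b := exists m, forall s, a <= s < b -> lo s <= m <= up s.

Lemma separated_right t : exists2 b, t < b & separated_on t b.
Proof.
have d3 : 0 < d / 3 by rewrite divr_gt0.
have [b1 tb1 H1] := at_right_dist_lt (reg_lo.1 t) d3.
have [b2 tb2 H2] := at_right_dist_lt (reg_up.1 t) d3.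
exists (Num.min b1 b2); first by rewrite lt_min tb1.
have := lo_up t => lut.
exists ((lo t + up t) / 2) => s; rewrite lt_min => /and3P[ts sb1 sb2].
move: ts; rewrite le_eqVlt => /predU1P[<-|ts]; first lra.
have := H1 s; rewrite ts sb1 ltr_norml => /(_ isT) ?.
have := H2 s; rewrite ts sb2 ltr_norml => /(_ isT) ?.
lra.
Qed.

Lemma separated_left t : exists2 a, a < t & separated_on a t.
Proof.
have d3 : 0 < d / 3 by rewrite divr_gt0.
have [b1 tb1 H1] := at_left_dist_lt (reg_lo.2 t) d3.
have [b2 tb2 H2] := at_left_dist_lt (reg_up.2 t) d3.
set l1 := lim _ in H1; set l2 := lim _ in H2.
exists (Num.max b1 b2); first by rewrite gt_max tb1.
(* The midpoint of the left limits separates: [lo s] is below both [l1 + d / 3] and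
   [l2 - 2 * d / 3], hence below their mean; dually for [up s]. *)
exists ((l1 + l2) / 2) => s; rewrite ge_max -andbA => /and3P[sb1 sb2 ts].
have := H1 s; rewrite ts sb1 ltr_norml => /(_ isT) ?.
have := H2 s; rewrite ts sb2 ltr_norml => /(_ isT) ?.
have := lo_up s; set t0 := Num.max b1 b2.
have := H1 t0; have := H2 t0.
rewrite le_max lexx le_max lexx orbT gt_max tb1 tb2 !ltr_norml => /(_ isT) ? /(_ isT) ?.
by have := lo_up t0; lra.
Qed.

(* The reflected path stays on the side of the separating level where it
   started, where at most one of the two barriers can act. *)
Lemma separated_monotone h a b : reflected lo up h -> separated_on a b ->
  (exists2 m, forall s, a <= s < b -> h s <= m &
     forall s t, a <= s -> s <= t -> t < b -> h s <= h t) \/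
  (exists2 m, forall s, a <= s < b -> m <= h s &
     forall s t, a <= s -> s <= t -> t < b -> h t <= h s).
Proof.
move=> [b_ P2 P3] [m sep].
have [ham|/ltW ham] := leP (h a) m; [left|right].
  have hm s : a <= s < b -> h s <= m.
    by move=> sab; apply: (P2 a) => //; [lra|move=> r rab; have := sep r; lra].
  exists m => // s t as_ st tb; apply: (P3 s) => // r rst.
  by have := sep r; have := hm s; lra.
have hm s : a <= s < b -> m <= h s.
  by move=> sab; apply: (P3 a) => //; [lra|move=> r rab; have := sep r; lra].
exists m => // s t as_ st tb; apply: (P2 s) => // r rst.
by have := sep r; have := hm s; lra.
Qed.

(** Just after [t], [lo] stays below [lo t + e <= h t + e], so the first comparison principle
    applies at that level. This is one half of right continuity; negation gives the other. *)
Lemma reflected_right h t e : reflected lo up h -> 0 < e ->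
  exists2 b, t < b & forall s, t < s < b -> h s <= h t + e.
Proof.
move=> [b_ P2 P3] e0; have [b tb H] := at_right_dist_lt (reg_lo.1 t) e0.
exists b => // s tsb; apply: (P2 t); [lra|lra|move=> r /andP[]].
have bt := b_ t; rewrite le_eqVlt => /predU1P[<- _|tr rs]; first lra.
by have := H r; rewrite ltr_norml; lra.
Qed.

Lemma reflected_left_cvg h t : reflected lo up h -> cvg (h s @[s --> t^'-]).
Proof.
move=> rh; have [a at_ sep] := separated_left t.
have [[m hm ndh]|[m hm nih]] := separated_monotone rh sep.
  exact: nondecreasing_left_cvg at_ hm ndh.
rewrite -[h]opprK; apply: is_cvgN.
apply: (@nondecreasing_left_cvg _ _ a t (- m)) => // [s sat|r s ar rs st] /=.
  by rewrite lerN2 hm.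
by rewrite lerN2 nih.
Qed.

Lemma total_variation_separated h a b : reflected lo up h -> a < b ->
  separated_on a b -> (total_variation a b h < +oo)%E.
Proof.
move=> rh ab sep; have [[m hm ndh]|[m hm nih]] := separated_monotone rh sep.
  apply: le_lt_trans (ltry _).
  (* At [b] the path may jump above [m], so the bound must also dominate [h b]. *)
  apply: (@nondecreasing_jump_total_variation _ h a b (Num.max m (h b))) => //.
    by move=> s /hm hs; rewrite le_max hs.
  by rewrite le_max lexx orbT.
rewrite -total_variationN; apply: le_lt_trans (ltry _).
apply: (@nondecreasing_jump_total_variation _ (\- h) a b (Num.max (- m) (- h b))) => //.
- by move=> s /hm hs; rewrite le_max /= lerN2 hs.
- by move=> s t as_ st tb /=; rewrite lerN2 nih.
- by rewrite le_max /= lexx orbT.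
Qed.

(** Real induction on the right endpoint: each time has a separated interval on either side, and on
    it [h] is monotone up to a final jump. *)
Lemma reflected_bounded_variation h a b : reflected lo up h -> a <= b ->
  bounded_variation a b h.
Proof.
move=> rh ab; apply/bounded_variationP => //.
rewrite ge0_fin_numE; last exact: total_variation_ge0.
move: b ab; apply: real_induction => [|t at_ tvt|t at_ tvt].
- by rewrite total_variationxx ltry.
- have [b tb sep] := separated_right t.
  exists b => // s /andP[ts sb].
  rewrite (total_variationD _ at_ (ltW ts)) lte_add_pinfty//.
  apply: total_variation_separated => //.
  by have [m H] := sep; exists m => r rts; apply: H; lra.
- have [b tb sep] := separated_left t.
  have [ab mt] : a <= Num.max a b /\ Num.max a b < t.
    by rewrite le_max lexx gt_max at_ tb.
  rewrite (total_variationD _ ab (ltW mt)) lte_add_pinfty//.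
    by apply: tvt; rewrite ab.
  apply: total_variation_separated => //.
  have [m H] := sep; exists m => r; rewrite ge_max -andbA => /and3P[_ br rt].
  by apply: H; rewrite br.
Qed.

(** A downward jump can only land on [up]. Shortly before [t], [h], and hence [up], exceeds [l - e].
    If [up t] does as well, the second principle keeps [h t] above [l - e]; otherwise it applies at
    level [up t] and gives [up t <= h t], a contradiction. *)
Lemma reflected_left_ge h t : reflected lo up h -> h t < up t ->
  lim (h s @[s --> t^'-]) <= h t.
Proof.
move=> rh hut; have [b_ P2 P3] := rh.
apply/ler_addgt0Pr => e e0.
have [a at_ H] := at_left_dist_lt (reflected_left_cvg (t := t) rh) e0.
set l := lim _ in H *; rewrite -lerBlDr.
have Ha := H a; rewrite lexx at_ ltr_norml in Ha; have {}Ha := Ha isT.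
have [le_up|up_lt] := leP (l - e) (up t).
  apply: (P3 a) => //; [lra|lra|move=> s /andP[as_]].
  rewrite le_eqVlt => /predU1P[->//|st].
  have := H s; rewrite as_ st ltr_norml => /(_ isT); have := b_ s; lra.
have : up t <= h t; last lra.
apply: (P3 a) => //; [lra|lra|move=> s /andP[as_]].
rewrite le_eqVlt => /predU1P[->//|st].
have := H s; rewrite as_ st ltr_norml => /(_ isT); have := b_ s; lra.
Qed.

(** Real induction on [h x <= h t]. To the right, [up] stays above [h t] for a while by right
    continuity; from the left, the second principle is applied at level [h x] or, if lower,
    [up t]. *)
Lemma reflected_nondecreasing h x q : reflected lo up h ->
  (forall s, x <= s <= q -> h s < up s) ->
  forall t, x <= t -> t <= q -> h x <= h t.
Proof.
move=> rh hup; have [b_ P2 P3] := rh.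
apply: real_induction => [//|t xt IH|t xt IH].
  have [tq|qt] := ltP t q; last by exists (t + 1); [lra|move=> s; lra].
  have hut := hup t; rewrite xt ltW// in hut; have {}hut := hut isT.
  have [|b tb H] := @at_right_dist_lt _ _ _ _ (reg_up.1 t) (up t - h t).
    by rewrite subr_gt0.
  exists b => // s /andP[ts sb] sq; apply: (le_trans (IH (ltW tq))).
  apply: (P3 t) => //; [exact: ltW|move=> r /andP[]].
  rewrite le_eqVlt => /predU1P[<-//|tr rs]; first lra.
  have := H r; rewrite tr (le_lt_trans rs sb) ltr_norml => /(_ isT); lra.
move=> tq; have hut := hup t; rewrite (ltW xt) tq in hut; have {}hut := hut isT.
have hs s : x <= s < t -> h x <= up s.
  move=> sx; have := IH s sx; have := b_ s; lra.
have [le_up|up_lt] := leP (h x) (up t).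
  apply: (P3 x) => //; [lra|move=> s /andP[xs]].
  by rewrite le_eqVlt => /predU1P[->//|st]; apply: hs; rewrite xs.
have : up t <= h t; last lra.
apply: (P3 x) => //; [lra|lra|move=> s /andP[xs]].
by rewrite le_eqVlt => /predU1P[->//|st]; have := hs s; rewrite xs st => /(_ isT); lra.
Qed.

(** Variation minus increment is twice the total descent, so this says that [h] hardly descends on a
    segment off [up], even when the segment is started slightly before [x]. That margin on the left
    is what controls an atom at [x]. *)
Lemma reflected_total_variation h x q e : reflected lo up h -> x <= q ->
  (forall s, x <= s <= q -> h s < up s) -> 0 < e ->
  exists2 s, s < x & (total_variation s q h <= (h q - h s + e)%:E)%E.
Proof.
move=> rh xq hup e0.
have ndh t : x <= t -> t <= q -> h x <= h t := reflected_nondecreasing rh hup (t := t).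
have hux := hup x; rewrite lexx xq in hux; have {}hux := hux isT.
have hlx := reflected_left_ge rh hux.
have tvxq : total_variation x q h = (h q - h x)%:E.
  apply: nondecreasing_total_variation => // s t.
  rewrite !in_itv/= => sxq txq st.
  apply: (@reflected_nondecreasing h s q) => //; last by lra.
  by move=> r rsq; apply: hup; lra.
have e2 : 0 < e / 2 by rewrite divr_gt0.
have [a ax H] := at_left_dist_lt (reflected_left_cvg (t := x) rh) e2.
set l := lim _ in hlx H.
have [b bx sep] := separated_left x.
pose s := Num.max a b; have [as_ bs sx] : [/\ a <= s, b <= s & s < x].
  by rewrite !le_max !lexx orbT gt_max ax bx.
have {}sep : separated_on s x.
  by have [m Hm] := sep; exists m => r rsx; apply: Hm; lra.
exists s => //; rewrite (total_variationD _ (ltW sx) xq) tvxq.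
have Hs := H s; rewrite as_ sx ltr_norml in Hs; have {}Hs := Hs isT.
have [[m hm ndhs]|[m hm nih]] := separated_monotone rh sep.
  have hl r : s <= r < x -> h r <= l.
    move=> rsx; apply: limr_ge; first exact: reflected_left_cvg.
    near=> y; apply: ndhs; [lra| |].
    - by apply: ltW; near: y; apply: nbhs_left_gt; lra.
    - by near: y; exact: nbhs_left_lt.
  rewrite nondecreasing_total_variation ?(ltW sx)//.
    by rewrite -EFinD lee_fin; lra.
  move=> r t; rewrite !in_itv/= => rsx /andP[st].
  rewrite le_eqVlt => /predU1P[->|tx] rt.
    by move: rt; rewrite le_eqVlt => /predU1P[->//|rx]; have := hl r; lra.
  by apply: ndhs => //; lra.
have lh r : s <= r < x -> l <= h r.
  move=> rsx; apply: limr_le; first exact: reflected_left_cvg.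
  near=> y; apply: nih; [lra| |].
  - by apply: ltW; near: y; apply: nbhs_left_gt; lra.
  - by near: y; exact: nbhs_left_lt.
(* Here [h] descends from [h s] to [l] before [x] and then only rises; the descent is less than
   [e / 2] and is counted twice. *)
apply: (@le_trans _ _ ((- l - (\- h) s + (- l - (\- h) x))%:E + (h q - h x)%:E)%E).
  rewrite leeD2r// -total_variationN.
  apply: nondecreasing_jump_total_variation => //=.
  - by move=> r /lh; lra.
  - by move=> r t sr rt tx; rewrite lerN2 nih.
  - by rewrite lerN2.
by rewrite -EFinD lee_fin /=; lra.
Unshelve. all: by end_near. Qed.

End reflected_theory.

Section reflected_symmetric.
Context {R : realType}.
Variables (d : R) (lo up : R -> R).
Hypotheses (d0 : 0 < d) (lo_up : forall t, lo t + d <= up t).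
Hypotheses (reg_lo : regulated lo) (reg_up : regulated up).
Implicit Types (h : R -> R).

Let nlo_up t : (\- up) t + d <= (\- lo) t.
Proof. by have := lo_up t; rewrite /=; lra. Qed.

Lemma reflected_regulated h : reflected lo up h -> regulated h.
Proof.
move=> rh; split=> t; last exact: (reflected_left_cvg d0 lo_up).
apply: dist_le_at_right => e e0.
have [b1 tb1 H1] := reflected_right reg_lo t rh e0.
have [b2 tb2 H2] := reflected_right (regulatedN reg_up) t (reflectedN rh) e0.
exists (Num.min b1 b2); first by rewrite lt_min tb1.
move=> s; rewrite lt_min => /and3P[ts sb1 sb2].
have := H1 s; rewrite ts sb1 => /(_ isT).
have := H2 s; rewrite ts sb2 => /(_ isT) /=.
by rewrite ler_norml; lra.
Qed.

Lemma reflected_left_le h t : reflected lo up h -> lo t < h t ->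
  h t <= lim (h s @[s --> t^'-]).
Proof.
move=> rh lh; have cl := reflected_left_cvg d0 lo_up reg_lo reg_up (t := t) rh.
have := reflected_left_ge d0 nlo_up (regulatedN reg_up) (regulatedN reg_lo)
  (t := t) (reflectedN rh).
by rewrite /= limN// !lerN2 ltrN2; apply.
Qed.

(** Real induction: agreement at [t] extends to a separated interval on its right, and agreement
    before [t] gives equal left limits, which the restrictions on jumps carry over to [t]. *)
Lemma reflected_unique a h g : reflected lo up h -> reflected lo up g ->
  h a = g a -> forall t, a <= t -> h t = g t.
Proof.
move=> rh rg hga; apply: real_induction => // [t at_ hgt|t at_ IH].
  have [b tb [m sep]] := separated_right d0 lo_up reg_lo reg_up t.
  exists b => // s /andP[ts sb].
  (* Below the separating level [f] is nondecreasing, so [f s] bounds [lo] on [[t, s]] and is a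
     level for the first principle on [k]. Above it [k] is nonincreasing and [k s] is a level for
     the second principle on [f]. *)
  have step (f k : R -> R) : reflected lo up f -> reflected lo up k ->
      f t = k t -> k s <= f s.
    move=> [bf P2 P3] [bk Q2 Q3] fkt; have [ftm|mft] := leP (f t) m.
      have fts u v : t <= u -> u <= v -> v < b -> f u <= f v.
        move=> tu uv vb.
        have fum : f u <= m.
          by apply: (P2 t) => // r rtu; have := sep r; lra.
        by apply: (P3 u) => // r ruv; have := sep r; lra.
      apply: (Q2 t); [lra|by rewrite -fkt; apply: fts; lra|].
      by move=> r rts; have := fts r s; have := bf r; lra.
    have kts u v : t <= u -> u <= v -> v < b -> k v <= k u.
      move=> tu uv vb.
      have kum : m <= k u.
        by apply: (Q3 t) => //; [lra|move=> r rtu; have := sep r; lra].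
      by apply: (Q2 u) => // r ruv; have := sep r; lra.
    apply: (P3 t); [lra|by rewrite fkt; apply: kts; lra|].
    by move=> r rts; have := kts r s; have := bk r; lra.
  by apply/eqP; rewrite eq_le !step.
have limE : lim (h s @[s --> t^'-]) = lim (g s @[s --> t^'-]).
  have cg := reflected_left_cvg (t := t) d0 lo_up reg_lo reg_up rg.
  apply: cvg_lim => //; apply: cvg_trans cg.
  apply: near_eq_cvg; near=> s; apply/esym/IH/andP; split.
    by near: s; apply: nbhs_left_ge.
  by near: s; apply: nbhs_left_lt.
(* If [f t < k t], then [f] is off [up] and [k] is off [lo] at [t], so [f] cannot jump down and [k]
   cannot jump up, against the equality of left limits. *)
have step (f k : R -> R) : reflected lo up f -> reflected lo up k ->
    lim (f s @[s --> t^'-]) = lim (k s @[s --> t^'-]) -> k t <= f t.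
  move=> rf rk fk; rewrite leNgt; apply/negP => fkt.
  have [bf _ _] := rf; have [bk _ _] := rk.
  have := @reflected_left_ge _ _ _ _ d0 lo_up reg_lo reg_up f t rf.
  have := @reflected_left_le k t rk.
  by rewrite fk; have := bf t; have := bk t; lra.
by apply/eqP; rewrite eq_le !step.
Unshelve. all: by end_near. Qed.

End reflected_symmetric.

(** * Lebesgue-Stieltjes measures *)

Section stieltjes_measure.
Context {R : realType}.
Implicit Types (f : cumulative R R) (A B G : set R).

Local Notation lsm f := (lebesgue_stieltjes_measure f).

Lemma lebesgue_stieltjes_oc f (a b : R) : a <= b ->
  lsm f `]a, b]%classic = (f b - f a)%:E.
Proof.
move=> ab; rewrite /lebesgue_stieltjes_measure /measure_extension.
by rewrite measurable_mu_extE/= ?wlength_itv_bnd//; exact: is_ocitv.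
Qed.

Lemma lebesgue_stieltjes_cc_eq0 f (x q : R) : x <= q ->
  (forall e, 0 < e -> exists2 s, s < x & f q - f s <= e) ->
  lsm f `[x, q]%classic = 0%E.
Proof.
move=> xq H; apply/eqP; rewrite -measure_le0; apply/lee_addgt0Pr => e /H[s sx fqs].
rewrite add0e; apply: (@le_trans _ _ (lsm f `]s, q]%classic)).
  apply: le_measure; rewrite ?inE; [exact: measurable_itv..|].
  by move=> y /=; rewrite !in_itv/= => /andP[xy ->]; rewrite (lt_le_trans sx xy).
by rewrite lebesgue_stieltjes_oc ?lee_fin//; lra.
Qed.

(** Continuity of the measure from above along the intervals []x - u n, q]], which decrease to
    [[x, q]]. *)
Lemma cumulative_left_small f (x q : R) : x <= q -> lsm f `[x, q]%classic = 0%E ->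
  forall e, 0 < e -> exists2 s, s < x & f q - f s < e.
Proof.
move=> xq f0 e e0.
have [u [u0 und ul]] : exists u : nat -> R, [/\ forall n, 0 < u n,
    forall m n, (m <= n)%N -> u n <= u m & forall z, 0 < z -> exists n, u n < z].
  exists (fun n => n.+1%:R^-1); split => [n|m n mn|z z0]; first by rewrite invr_gt0.
    by rewrite lef_pV2 ?posrE// ler_nat ltnS.
  by have [n _ /(_ n (leqnn n))] := near_infty_natSinv_lt (PosNum z0); exists n.
pose F n := `]x - u n, q]%classic.
have FE : \bigcap_n F n = `[x, q]%classic.
  apply/seteqP; split => y /=; last first.
    by rewrite in_itv/= => xyq n _; rewrite /F/= in_itv/=; have := u0 n; lra.
  move=> Fy; have := Fy 0%N I; rewrite /F /= !in_itv/= => /andP[_ ->]; rewrite andbT.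
  rewrite leNgt; apply/negP => yx; have [|n un] := ul (x - y); first by rewrite subr_gt0.
  by have := Fy n I; rewrite /F /= in_itv/=; lra.
have lsmF n : lsm f (F n) = (f q - f (x - u n))%:E.
  by rewrite lebesgue_stieltjes_oc//; have := u0 n; lra.
have Fcvg : (lsm f \o F) n @[n --> \oo] --> 0%E.
  rewrite -f0 -FE; apply: nonincreasing_cvg_mu.
  - by rewrite [X in (X < _)%E]lsmF ltry.
  - by move=> n; exact: measurable_itv.
  - by rewrite FE; exact: measurable_itv.
  - move=> m n mn; apply/subsetPset => y; rewrite /F /= !in_itv/=.
    by have := und _ _ mn; lra.
have [n _ Hn] : \forall n \near \oo, ((lsm f \o F) n < e%:E)%E.
  have : nbhs (0%E : \bar R) [set y | (y < e%:E)%E].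
    by apply: open_nbhs_nbhs; split; [exact: open_ereal_lt_ereal|rewrite /= lte_fin].
  by move=> /Fcvg.
exists (x - u n); first by have := u0 n; lra.
by have := Hn n (leqnn n); rewrite /= lsmF lte_fin.
Qed.

(** [A] and [B] are arbitrary sets, so monotonicity is read off the definition of the integral as a
    supremum over simple functions. *)
Lemma le_integral_indic
    (mu : {measure set (g_sigma_algebraType R.-ocitv.-measurable) -> \bar R})
    (D A B : set R) : D `&` A `<=` B ->
  (\int[mu]_(s in D) (\1_A s)%:E <= \int[mu]_(s in D) (\1_B s)%:E)%E.
Proof.
move=> AB; rewrite !ge0_integralE; try by move=> x _; rewrite lee_fin.
apply: ereal_sup_le => _ [h hA <-]; exists h => // x.
apply: le_trans (hA x) _; rewrite /patch; case: ifPn => // /set_mem Dx.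
rewrite lee_fin !indicE ler_nat.
by have [/set_mem Ax|//] := boolP (x \in A); rewrite mem_set//; exact: AB.
Qed.

Lemma integral_indic_negligible f D A G : measurable D ->
  (lsm f).-negligible G -> D `&` A `<=` G ->
  (\int[lsm f]_(s in D) (\1_A s)%:E = 0)%E.
Proof.
move=> mD [N [mN N0 GN]] AG; apply/eqP; rewrite eq_le; apply/andP; split.
  apply: (@le_trans _ _ (\int[lsm f]_(s in D) (\1_N s)%:E)%E).
    by apply: le_integral_indic; apply: subset_trans GN.
  rewrite integral_indic// -N0; apply: le_measure; rewrite ?inE//.
  exact: measurableI.
by apply: integral_ge0 => x _; rewrite lee_fin.
Qed.

Lemma integral_indic_eq0 f D A B : measurable D -> measurable B ->
  (\int[lsm f]_(s in D) (\1_A s)%:E = 0)%E -> B `<=` D `&` A -> lsm f B = 0%E.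
Proof.
move=> mD mB A0 BDA; have BD : B `&` D = B by apply/setIidl => x /BDA[].
have := @integral_indic _ _ _ (lsm f) D mD B mB; rewrite BD => IB.
have : (\int[lsm f]_(s in D) (\1_B s)%:E <= \int[lsm f]_(s in D) (\1_A s)%:E)%E.
  by apply: le_integral_indic => x [_ /BDA[]].
by rewrite IB A0 measure_le0 => /eqP.
Qed.

(* Covers [G] by the segments with rational endpoints that it contains and, for
   each rational [q], the singleton of a point of [G] where a segment of [G]
   ending at [q] cannot be prolonged to the left. *)
Lemma negligible_right_open
    (mu : {measure set (g_sigma_algebraType R.-ocitv.-measurable) -> \bar R}) G :
  (forall x, G x -> exists2 b, x < b & `[x, b[ `<=` G) ->
  (forall x q, x <= q -> `[x, q] `<=` G -> mu `[x, q]%classic = 0%E) ->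
  mu.-negligible G.
Proof.
move=> Gr G0.
pose S (q r : rat) : set R :=
  [set x | `[ratr r, ratr q] `<=` G /\ x \in `[ratr r, ratr q]].
pose E (q : rat) : set R := [set x | [/\ x <= ratr q, `[x, ratr q] `<=` G &
  forall y, y < x -> ~ (`[y, ratr q] `<=` G)]].
pose F n := if unpickle n is Some (q, o) then
  (if o is Some r then S q r else E q) else set0.
have seg0 x q : x <= q -> `[x, q] `<=` G -> mu.-negligible `[x, q]%classic.
  move=> xq xqG; exists `[x, q]%classic.
  by split; [exact: (measurable_itv `[x, q])|exact: G0|by []].
have rat_between (a b : R) : a < b -> exists r, a < ratr r < b.
  by move=> ab; have [r] := rat_in_itvoo ab; rewrite in_itv/=; exists r.
have FG : G `<=` \bigcup_n F n.
  move=> x Gx; have [b xb xbG] := Gr x Gx.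
  have [q /andP[xq qb]] := rat_between x b xb.
  have xqG : `[x, ratr q] `<=` G.
    by move=> y; rewrite /= in_itv/= => yxq; apply: xbG; rewrite /= in_itv/=; lra.
  have [[y yx yqG]|nex] := pselect (exists2 y, y < x & `[y, ratr q] `<=` G).
    have [r /andP[yr rx]] := rat_between y x yx.
    exists (pickle (q, Some r)); [exact: I|rewrite /F pickleK; split].
      by move=> z; rewrite /= in_itv/= => zrq; apply: yqG; rewrite /= in_itv/=; lra.
    by rewrite in_itv/=; lra.
  exists (pickle (q, @None rat)); [exact: I|rewrite /F pickleK].
  split; [exact: ltW|exact: xqG|move=> y yx yqG; apply: nex; by exists y].
suff : mu.-negligible (\bigcup_n F n) by apply: negligibleS; exact: FG.
apply: negligible_bigcup => n; rewrite /F; case: unpickle => [[q [r|]]|].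
- have [[rqG rq]|H] := pselect (`[ratr r, ratr q] `<=` G /\ (ratr r : R) <= ratr q).
    by apply: negligibleS (seg0 _ _ rq rqG) => x [].
  apply: negligibleS (negligible_set0 _) => x [rqG]; rewrite in_itv/= => rxq.
  by apply: H; split => //; lra.
- have [[x [xq xqG xmin]]|H] := pselect (exists x, E q x).
    have xxG : `[x, x] `<=` G.
      by move=> y; rewrite /= in_itv/= => yx; apply: xqG; rewrite /= in_itv/=; lra.
    apply: negligibleS (seg0 _ _ (lexx x) xxG) => y [yq yqG ymin] /=.
    rewrite in_itv/=; apply/andP; split; rewrite leNgt; apply/negP => yx.
      by have := xmin _ yx yqG.
    by have := ymin _ yx xqG.
  by apply: negligibleS (negligible_set0 _) => x Ex; apply: H; exists x.
- exact: negligible_set0.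
Qed.

(** After the last time [sup A] at which the path is at most [m], it lies above [m >= lo], where
    [Kl] does not grow; as [Kr] never decreases, the path cannot rise above [m]. *)
Lemma cumulative_sub_le (Kl Kr : cumulative R R) (lo : R -> R) :
  (forall A, measurable A -> A `<=` [set s | lo s < Kl s - Kr s] ->
     lsm Kl A = 0%E) ->
  forall u t m, u <= t -> Kl u - Kr u <= m ->
    (forall s, u <= s <= t -> lo s <= m) -> Kl t - Kr t <= m.
Proof.
move=> null u t m ut um lom; rewrite leNgt; apply/negP => mt.
pose A := [set s | u <= s <= t /\ Kl s - Kr s <= m].
have Au : A u by split=> //; rewrite lexx.
have sA : has_sup A by split; [exists u|exists t => s [] /andP[]].
have uA : u <= sup A := ub_le_sup sA.2 Au.
have At : sup A <= t by apply: ge_sup; [exists u|move=> s [] /andP[]].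
have gtA s : sup A < s <= t -> m < Kl s - Kr s.
  move=> /andP[As st]; rewrite ltNge; apply/negP => sm.
  have : s <= sup A by apply: (ub_le_sup sA.2); split => //; lra.
  lra.
have Krt s : s <= t -> Kr s <= Kr t by move=> st; exact: cumulative_is_nondecreasing.
have [Am|mA] := leP (Kl (sup A) - Kr (sup A)) m.
  have : lsm Kl `]sup A, t]%classic = 0%E.
    apply: null; first exact: measurable_itv.
    move=> s; rewrite /= in_itv/= => sAt; apply: le_lt_trans (gtA s sAt).
    by apply: lom; lra.
  by rewrite lebesgue_stieltjes_oc// => -[]; have := Krt _ At; lra.
(* If [sup A] is not attained, the path is above [lo] there too, so the atom at [sup A] is also
   null. Hence [Kl] grows by less than the excess over [m] from some earlier time, after which there
   is still a point of [A]. *)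
have ltA : lsm Kl `[sup A, t]%classic = 0%E.
  apply: null; first exact: measurable_itv.
  move=> s; rewrite /= in_itv/= => /andP[]; rewrite le_eqVlt => /predU1P[<-|As] st.
    by apply: le_lt_trans mA; apply: lom; lra.
  by apply: le_lt_trans (gtA s _); [apply: lom; lra|rewrite As st].
have [|s sltA small] := cumulative_left_small At ltA (e := Kl t - Kr t - m).
  by rewrite subr_gt0.
have [|r [/andP[ur rt] rm] sr] := @sup_adherent _ A (sup A - s) _ sA.
  by rewrite subr_gt0.
have : Kl s <= Kl r by apply: cumulative_is_nondecreasing; lra.
have := Krt _ rt; lra.
Qed.

End stieltjes_measure.

(** * The pushing measures of a reflected path *)

Section compensator.
Context {R : realType}.
Variables (d : R) (lo up : R -> R).
Hypotheses (d0 : 0 < d) (lo_up : forall t, lo t + d <= up t).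
Hypotheses (reg_lo : regulated lo) (reg_up : regulated up).

(** [K] is the decreasing half of the Jordan decomposition of [h]. Variation is counted from -1, so
    a jump of [h] at time 0 becomes an atom. On a segment off [up] it hardly grows, and
    [negligible_right_open] passes from segments to the whole set. *)
Lemma reflected_compensator (h : R -> R) : reflected lo up h ->
  (forall t, t < 0 -> h t = 0) ->
  exists K : cumulative R R, [/\ forall t, t < 0 -> K t = 0,
    forall t, 0 <= t -> K t = (fine (total_variation (-1) t h) - h t) / 2 &
    (lebesgue_stieltjes_measure K).-negligible [set s | h s < up s]].
Proof.
move=> rh h0; pose tv s t := fine (total_variation s t h).
have tv_fin s t : s <= t -> total_variation s t h \is a fin_num.
  by move=> st; apply/bounded_variationP/(reflected_bounded_variation d0 lo_up).
have tvD s r t : s <= r -> r <= t -> tv s t = tv s r + tv r t.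
  move=> sr rt; rewrite /tv (total_variationD _ sr rt) fineD//; exact: tv_fin.
have tv0 s t : s <= t -> t < 0 -> tv s t = 0.
  move=> st tlt0; rewrite /tv nondecreasing_total_variation//.
    by rewrite !h0 ?subrr//; lra.
  by move=> x y; rewrite !in_itv/= => xst yst _; rewrite !h0//; lra.
(* The cut at 0 makes [W] vanish also before -1; as [h] vanishes at negative times, the increment
   formula [WB] holds for all times. *)
pose W t := if t < 0 then 0 else (tv (-1) t - h t) / 2.
have Wpos t : 0 <= t -> W t = (tv (-1) t - h t) / 2 by rewrite /W ltNge => ->.
have Wneg t : t < 0 -> W t = 0 by rewrite /W => ->.
have WB s t : s <= t -> W t - W s = (tv s t - (h t - h s)) / 2.
  move=> st; have [tlt0|t0] := ltP t 0.
    have slt0 : s < 0 by lra.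
    by rewrite !Wneg// tv0// !h0//; lra.
  rewrite (Wpos t)//; have [slt0|s0] := ltP s 0; last first.
    have m1s : -1 <= s by lra.
    by rewrite Wpos// (tvD _ _ _ m1s st); lra.
  rewrite (Wneg s)// (h0 s)//; have [sm1|m1s] := leP s (-1).
    have m1t : -1 <= t by lra.
    by rewrite (tvD _ _ _ sm1 m1t) (tv0 _ _ sm1 (ltrN10 R)); lra.
  by rewrite (tvD _ _ _ (ltW m1s) st) (tv0 _ _ (ltW m1s) slt0); lra.
have ndW : nondecreasing W.
  move=> s t st; rewrite -subr_ge0 WB// divr_ge0// subr_ge0.
  rewrite -lee_fin fineK; last exact: tv_fin.
  by apply: le_trans (total_variation_ge _ st); rewrite lee_fin ler_norm.
have rcW : right_continuous W.
  move=> t; have [tlt0|t0] := ltP t 0.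
    apply: dist_le_at_right => e e0; exists 0 => // s /andP[ts s0].
    by rewrite -/(W s) (Wneg s s0) (Wneg t tlt0) subr0 normr0 ltW.
  have WE s : 0 <= s -> W s = fine (neg_tv (-1) h s).
    move=> s0; have m1s : -1 <= s by lra.
    rewrite /neg_tv fineM// ?fin_numB ?tv_fin// fineB// ?tv_fin//.
    by rewrite Wpos.
  suff : W s @[s --> t^'+] --> fine (neg_tv (-1) h t) by rewrite -WE.
  apply: cvg_trans (neg_tv_right_continuous (a := -1) (b := t + 1) _ _ _ _).
  - apply: near_eq_cvg; near=> s; rewrite WE//=.
    by apply: (le_trans t0); near: s; exact: nbhs_right_ge.
  - lra.
  - lra.
  - by apply: (reflected_bounded_variation d0 lo_up) => //; lra.
  - exact: (reflected_regulated d0 lo_up reg_lo reg_up rh).1.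
pose K : cumulative R R := HB.pack W (isCumulative.Build R _ R W ndW rcW).
exists K; split => //.
apply: negligible_right_open => [x hx|x q xq xqG].
  have rg := reflected_regulated d0 lo_up reg_lo reg_up rh.
  have e0 : 0 < (up x - h x) / 2 by rewrite divr_gt0// subr_gt0.
  have [b1 xb1 H1] := at_right_dist_lt (rg.1 x) e0.
  have [b2 xb2 H2] := at_right_dist_lt (reg_up.1 x) e0.
  exists (Num.min b1 b2); first by rewrite lt_min xb1.
  move=> s; rewrite /= in_itv/= lt_min => /and3P[].
  rewrite le_eqVlt => /predU1P[<-//|xs] sb1 sb2.
  have := H1 s; rewrite xs sb1 ltr_norml => /(_ isT).
  have := H2 s; rewrite xs sb2 ltr_norml => /(_ isT).
  lra.
apply: lebesgue_stieltjes_cc_eq0 => // e e0.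
have [|s sx tvs] := reflected_total_variation d0 lo_up reg_lo reg_up rh xq _ e0.
  by move=> s sxq; apply: xqG; rewrite /= in_itv.
exists s => //; have sq : s <= q by lra.
rewrite /= WB//; move: tvs; rewrite -(fineK (tv_fin _ _ sq)) lee_fin -/(tv s q).
lra.
Unshelve. all: by end_near. Qed.

End compensator.

(** * The explicit formula *)

Section roots.
Context {R : realType}.
Implicit Types (F : R -> R -> R) (f g : R -> R) (c C : R).

Lemma bilipschitz_root f c C : 0 < c -> c < C -> {homo f : x y / x <= y} ->
  (forall x y, c * `|x - y| <= `|f x - f y| <= C * `|x - y|) ->
  exists p, f p = 0.
Proof.
move=> c0 cC ndf bf; have C0 : 0 < C by lra.
have ctsf : continuous f.
  move=> x; apply/cvgrPdist_le => e e0; near=> y.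
  (* The upper Lipschitz bound gives continuity with radius [e / C]. *)
  have /andP[_ /le_trans->//] := bf x y.
  rewrite mulrC -ler_pdivlMr//; near: y.
  by apply: cvgr_dist_le; [exact: cvg_id|rewrite divr_gt0].
(* Over a distance [z] the lower bound forces [f] to move by at least [|f 0|], so [f] changes sign
   on [[- z, z]]. *)
pose z := `|f 0| / c; have z0 : 0 <= z by rewrite divr_ge0// ltW.
have zE : c * z = `|f 0| by rewrite mulrC divfK// gt_eqF.
have fz : 0 <= f z.
  have := bf z 0; rewrite subr0 (ger0_norm z0) zE => /andP[+ _].
  rewrite (ger0_norm (_ : 0 <= f z - f 0)) ?subr_ge0 ?ndf//.
  by have := ler_norm (- f 0); rewrite normrN; lra.
have fNz : f (- z) <= 0.
  have := bf 0 (- z); rewrite sub0r opprK (ger0_norm z0) zE => /andP[+ _].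
  rewrite (ger0_norm (_ : 0 <= f 0 - f (- z))) ?subr_ge0 ?ndf ?oppr_le0//.
  by have := ler_norm (f 0); lra.
have [||p _ fp] := @IVT R f (- z) z 0 _ (continuous_subspaceT ctsf); last by exists p.
- lra.
- by rewrite ge_min fNz le_max fz orbT.
Unshelve. all: by end_near. Qed.

(** The lower Lipschitz bound controls the distance from [rho s] to a point [x] by [|F s x| / c].
    With [x = rho t] this gives right continuity. The pointwise left limit [G] of [F] inherits
    monotonicity and both bounds, and its root is the left limit of [rho]. *)
Lemma cadlag_root F (rho : R -> R) c C : 0 < c -> c < C ->
  (forall x, cadlag (F ^~ x)) ->
  (forall t, 0 <= t -> {homo F t : x y / x <= y}) ->
  (forall t x y, 0 <= t ->
     c * `|x - y| <= `|F t x - F t y| <= C * `|x - y|) ->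
  (forall t, 0 <= t -> F t (rho t) = 0) -> cadlag rho.
Proof.
move=> c0 cC cF ndF bF rhoF; split=> t t0.
  apply: dist_le_at_right => e e0.
  have [b tb H] := at_right_dist_lt ((cF (rho t)).1 t t0) (mulr_gt0 c0 e0).
  exists b => // s /andP[ts sb]; have s0 : 0 <= s by lra.
  have := H s; rewrite ts sb rhoF// subr0 => /(_ isT) Hs.
  have /andP[le_c _] := bF s (rho s) (rho t) s0.
  rewrite -(ler_pM2l c0); apply: le_trans le_c _.
  by rewrite rhoF// sub0r normrN ltW.
pose G x := lim (F s x @[s --> t^'-]).
have FG x e : 0 < e -> exists2 a, 0 <= a < t & forall s, a <= s < t ->
    `|F s x - G x| < e.
  move=> e0; have [a at_ H] := at_left_dist_lt ((cF x).2 t t0) e0.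
  exists (Num.max 0 a); first by rewrite le_max lexx gt_max t0.
  by move=> s; rewrite ge_max -andbA => /and3P[_ as_ st]; apply: H; rewrite as_.
have approx x y e : 0 < e -> exists2 s, 0 <= s &
    `|F s x - G x| < e /\ `|F s y - G y| < e.
  move=> e0; have [a /andP[a0 at_] Ha] := FG x e e0.
  have [b /andP[b0 bt] Hb] := FG y e e0; exists (Num.max a b).
    by rewrite le_max a0.
  by split; [apply: Ha|apply: Hb]; rewrite le_max lexx ?orbT gt_max at_ bt.
have ndG : {homo G : x y / x <= y}.
  move=> x y xy; apply/ler_addgt0Pr => e e0.
  have [s s0] := approx x y (e / 2) (divr_gt0 e0 (ltr0Sn _ 1)).
  by rewrite !ltr_norml; have := ndF s s0 x y xy; lra.
have bG x y : c * `|x - y| <= `|G x - G y| <= C * `|x - y|.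
  have tri (a b a' b' e : R) : `|a - a'| < e / 2 -> `|b - b'| < e / 2 ->
      `|a - b| <= `|a' - b'| + e.
    rewrite !ltr_norml => h1 h2; have := ler_norm (a' - b').
    by have := ler_norm (- (a' - b')); rewrite normrN ler_norml; lra.
  apply/andP; split; apply/ler_addgt0Pr => e e0;
    have [s s0 [h1 h2]] := approx x y (e / 2) (divr_gt0 e0 (ltr0Sn _ 1));
    have /andP[lo_ up_] := bF s x y s0.
    exact: le_trans lo_ (tri _ _ _ _ _ h1 h2).
  rewrite distrC in h1; rewrite distrC in h2.
  by have := tri _ _ _ _ _ h1 h2; lra.
have [r Gr] := bilipschitz_root c0 cC ndG bG.
apply/cvg_ex; exists r; apply: dist_le_at_left => e e0.
have [a /andP[a0 at_] H] := FG r (c * e) (mulr_gt0 c0 e0).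
exists a => // s /andP[as_ st]; have s0 : 0 <= s by lra.
have := H s; rewrite (ltW as_) st Gr subr0 => /(_ isT) Hs.
have /andP[le_c _] := bF s (rho s) r s0.
rewrite -(ler_pM2l c0); apply: le_trans le_c _.
by rewrite rhoF// sub0r normrN ltW.
Qed.

Lemma cadlag_eq f g : (forall t, 0 <= t -> f t = g t) -> cadlag f -> cadlag g.
Proof.
move=> fg [fr fl]; split=> t t0.
  rewrite -fg//; apply: cvg_trans (fr t t0); apply: near_eq_cvg.
  near=> s; apply: fg; apply: le_trans t0 _; near: s; exact: nbhs_right_ge.
apply: cvgP (_ : _ --> lim (f s @[s --> t^'-])); apply: cvg_trans (fl t t0).
apply: near_eq_cvg; near=> s; apply: fg; near: s; exact: nbhs_left_ge.
Unshelve. all: by end_near. Qed.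

Lemma cadlagD f g : cadlag f -> cadlag g -> cadlag (f \+ g).
Proof.
move=> [fr fl] [gr gl]; split=> t t0; first exact: cvgD (fr t t0) (gr t t0).
exact: is_cvgD (fl t t0) (gl t t0).
Qed.

Lemma cadlagN f : cadlag f -> cadlag (\- f).
Proof.
move=> [fr fl]; split=> t t0; first exact: cvgN (fr t t0).
exact: is_cvgN (fl t t0).
Qed.

Lemma regulated_cadlag f : regulated f -> cadlag f.
Proof. by move=> [fr fl]; split=> t _. Qed.

Lemma cadlag_regulated f k : cadlag f ->
  regulated (fun t => if t < 0 then k else f t).
Proof.
move=> [fr fl]; split=> t.
  have [tlt0|t0] := ltP t 0.
    by apply: dist_le_at_right => e e0; exists 0 => // s /andP[_ ->];
      rewrite subrr normr0 ltW.
  apply: cvg_trans (fr t t0); apply: near_eq_cvg; near=> s.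
  rewrite ltNge (_ : 0 <= s)//; apply: le_trans t0 _.
  by near: s; exact: nbhs_right_ge.
have [t0|t0] := ltP 0 t.
  apply: cvgP (_ : _ --> lim (f s @[s --> t^'-])); apply: cvg_trans (fl t t0).
  apply: near_eq_cvg; near=> s; rewrite ltNge (_ : 0 <= s)//.
  by near: s; exact: nbhs_left_ge.
apply/cvg_ex; exists k; apply: dist_le_at_left => e e0.
exists (t - 1); first lra.
by move=> s /andP[_ st]; rewrite (lt_le_trans st t0) subrr normr0 ltW.
Unshelve. all: by end_near. Qed.

Lemma regulated_bounded_below f a b : regulated f -> a <= b ->
  exists m, forall s, a <= s <= b -> m <= f s.
Proof.
move=> [fr fl]; move: b; apply: real_induction => [|t at_ [m Hm]|t at_ IH].
- by exists (f a) => s; rewrite andbC -eq_le => /eqP->.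
- have [b tb H] := at_right_dist_lt (fr t) ltr01.
  exists b => // s /andP[ts sb]; exists (Num.min m (f t - 1)) => r /andP[ar rs].
  rewrite ge_min; have [rt|tr] := leP r t; first by rewrite Hm ?ar.
  by have := H r; rewrite tr (le_lt_trans rs sb) ltr_norml => /(_ isT); lra.
- have [b bt H] := at_left_dist_lt (fl t) ltr01; set l := lim _ in H.
  have [ab mt] : a <= Num.max a b /\ Num.max a b < t.
    by rewrite le_max lexx gt_max at_ bt.
  have [|m Hm] := IH (Num.max a b); first by rewrite ab.
  exists (Num.min (f t) (Num.min m (l - 1))) => r /andP[ar].
  rewrite !ge_min le_eqVlt => /predU1P[->|rt]; first by rewrite lexx.
  have [rb|br] := leP r (Num.max a b); first by rewrite Hm ?orbT ?ar.
  have := H r; rewrite rt andbT (le_trans _ (ltW br)) ?le_max ?lexx ?orbT//.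
  rewrite ltr_norml => /(_ isT) /andP[+ _]; rewrite ltrBrDl => /ltW.
  by rewrite addrC => ->; rewrite !orbT.
Qed.

End roots.

(** * The formula satisfies the comparison principles *)

Section reflection_formula.
Context {R : realType}.
Variables (d : R) (Phi Psi : R -> R).
Hypotheses (d0 : 0 < d) (Psi_Phi : forall t, 0 <= t -> Psi t + d <= Phi t).
Hypothesis Psi_cadlag : cadlag Psi.

Let lo t := if t < 0 then - d else - Phi t.
Let up t := if t < 0 then d else - Psi t.
Let h t := if t < 0 then 0 else - reflection_term Phi Psi t.

Let iPsi s t := inf [set - Psi r | r in `[s, t]].

Let inf_Psi s t : 0 <= s -> s <= t -> has_inf [set - Psi r | r in `[s, t]].
Proof.
move=> s0 st; split; first by exists (- Psi s), s => //=; rewrite in_itv/= lexx.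
have [m Hm] := regulated_bounded_below (cadlag_regulated 0 (cadlagN Psi_cadlag)) st.
exists m => _ [r /= + <-]; rewrite in_itv/= => rst.
have := Hm r rst; rewrite ltNge (_ : 0 <= r)//; lra.
Qed.

Let iPsi_le s r t : 0 <= s -> s <= r -> r <= t -> iPsi s t <= - Psi r.
Proof.
move=> s0 sr rt; apply: (ge_inf (inf_Psi s0 (le_trans sr rt)).2).
by exists r => //=; rewrite in_itv/= sr.
Qed.

Let le_iPsi s t m : 0 <= s -> s <= t ->
  (forall r, s <= r <= t -> m <= - Psi r) -> m <= iPsi s t.
Proof.
move=> s0 st Hm; apply: lb_le_inf; first by have [] := inf_Psi s0 st.
by move=> _ [r /= + <-]; rewrite in_itv/=; exact: Hm.
Qed.

Let h_le t m : 0 <= t ->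
  (h t <= m) <-> (Num.min (Num.max (- Phi 0) 0) (iPsi 0 t) <= m /\
    forall s, 0 <= s <= t -> Num.min (- Phi s) (iPsi s t) <= m).
Proof.
move=> t0; rewrite /h ltNge t0 /= /reflection_term opprK ge_max.
have ne : [set Num.min (- Phi s) (iPsi s t) | s in `[0, t]] !=set0.
  by exists (Num.min (- Phi 0) (iPsi 0 t)), 0 => //=; rewrite in_itv/= lexx.
have ub : has_ubound [set Num.min (- Phi s) (iPsi s t) | s in `[0, t]].
  exists (- Psi t) => _ [s /= + <-]; rewrite in_itv/= => /andP[s0 st].
  by rewrite ge_min iPsi_le ?orbT.
split=> [/andP[-> supm]|[-> H]].
  split=> // s st; apply: le_trans supm; apply: (ub_le_sup ub).
  by exists s => //=; rewrite in_itv.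
by apply: ge_sup => // _ [s /= + <-]; rewrite in_itv/=; exact: H.
Qed.

(** As [t] grows the running infima decrease, so old terms of the formula decrease and new ones are
    at most [lo s]: the first principle. While [up >= m], extending an infimum cannot take it below
    [m]: the second. *)
Lemma reflection_term_reflected : reflected lo up h.
Proof.
have hneg t : t < 0 -> h t = 0 by rewrite /h => ->.
have loneg t : t < 0 -> lo t = - d by rewrite /lo => ->.
have upneg t : t < 0 -> up t = d by rewrite /up => ->.
have lopos t : 0 <= t -> lo t = - Phi t by rewrite /lo ltNge => ->.
have uppos t : 0 <= t -> up t = - Psi t by rewrite /up ltNge => ->.
have iPsi_tt t : 0 <= t -> - Psi t <= iPsi t t.
  by move=> t0; apply: le_iPsi => // r; rewrite andbC -eq_le => /eqP->.
have P1 t : lo t <= h t <= up t.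
  have [tlt0|t0] := ltP t 0; first by rewrite loneg// upneg// hneg//; have := d0; lra.
  rewrite lopos// uppos//; apply/andP; split.
    have [_ /(_ t)] := (h_le _ t0).1 (lexx _); rewrite t0 lexx => /(_ isT).
    rewrite ge_min => /orP[//|it]; have := d0.
    by have := iPsi_tt _ t0; have := Psi_Phi t0; lra.
  apply/h_le => //; split; first by rewrite ge_min iPsi_le ?orbT.
  by move=> s /andP[s0 st]; rewrite ge_min (iPsi_le s0 st (lexx t)) orbT.
have P2 u t m : 0 <= u -> u <= t -> h u <= m ->
    (forall s, u <= s <= t -> lo s <= m) -> h t <= m.
  move=> u0 ut /(h_le _ u0)[h1 h2] lom; have t0 := le_trans u0 ut.
  have iut s : 0 <= s -> s <= u -> iPsi s t <= iPsi s u.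
    by move=> s0 su; apply: le_iPsi => // r rsu; apply: iPsi_le => //; lra.
  apply/h_le => //; split=> [|s /andP[s0 st]].
    apply: le_trans h1; rewrite le_min ge_min lexx/= ge_min.
    by rewrite iut ?orbT.
  have [su|us] := leP s u.
    apply: (le_trans _ (h2 s _)); last by rewrite s0.
    by rewrite le_min ge_min lexx/= ge_min iut ?orbT.
  by rewrite ge_min -lopos// lom// (ltW us).
have P3 u t m : 0 <= u -> u <= t -> m <= h u ->
    (forall s, u <= s <= t -> m <= up s) -> m <= h t.
  move=> u0 ut mu upm; have t0 := le_trans u0 ut.
  have iut s m' : 0 <= s -> s <= u -> m' <= m -> m' <= iPsi s u -> m' <= iPsi s t.
    move=> s0 su m'm m'i; apply: le_iPsi => //; first lra.
    move=> r /andP[sr rt]; have [ru|ur] := leP r u.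
      exact: le_trans m'i (iPsi_le s0 sr ru).
    by apply: le_trans m'm _; rewrite -uppos ?upm ?(ltW ur)//; lra.
  rewrite leNgt; apply/negP => htm.
  have [h1 h2] := (h_le (h t) t0).1 (lexx _).
  (* A term above [e] in the formula for [h u] would persist and force [e <= h t], whereas [e] lies
     strictly between [h t] and [m]. *)
  pose e := (m + h t) / 2; suff : h u <= e by rewrite /e; lra.
  have [em te] : e <= m /\ h t < e by rewrite /e; split; lra.
  apply/h_le => //; split=> [|s /andP[s0 su]].
    rewrite leNgt lt_min; apply/negP => /andP[e1 e2].
    have : e <= h t; last lra.
    apply: le_trans h1; rewrite le_min (ltW e1) /=.
    by apply: iut => //; exact: ltW.
  rewrite leNgt lt_min; apply/negP => /andP[e1 e2].
  have : e <= h t; last lra.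
  apply: (le_trans _ (h2 s _)); last by rewrite s0; lra.
  by rewrite le_min (ltW e1) /=; apply: iut => //; exact: ltW.
(* These bounds carry the principles from value 0 before time 0 across the initial jump; the lower
   one comes from the term with the positive part. *)
have [h0min h0max] : h 0 <= Num.max (- Phi 0) 0 /\ Num.min 0 (- Psi 0) <= h 0.
  split; first apply/h_le => //.
    split; first by rewrite ge_min lexx.
    move=> s; rewrite andbC -eq_le => /eqP->.
    by rewrite ge_min le_max lexx.
  have [h1 _] := (h_le (h 0) (lexx 0)).1 (lexx _); apply: le_trans h1.
  by rewrite le_min ge_min le_max lexx orbT/= ge_min iPsi_tt ?orbT.
split=> // u t m ut hum Hm.
  have [u0|u0] := leP 0 u; first exact: P2 u0 ut hum Hm.
  rewrite hneg// in hum; have [tlt0|t0] := ltP t 0; first by rewrite hneg.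
  apply: (P2 0) => // [|s s0t]; last by apply: Hm; lra.
  by apply: (le_trans h0min); rewrite ge_max -lopos// hum Hm//; lra.
have [u0|u0] := leP 0 u; first exact: P3 u0 ut hum Hm.
rewrite hneg// in hum; have [tlt0|t0] := ltP t 0; first by rewrite hneg.
apply: (P3 0) => // [|s s0t]; last by apply: Hm; lra.
by apply: le_trans _ h0max; rewrite le_min -uppos// hum Hm//; lra.
Qed.

End reflection_formula.

(** * Transfer between the half-line and the whole line *)

Lemma eq_bounded_variation {R : realType} (f g : R -> R) (a b : R) : a <= b ->
  (forall t, a <= t <= b -> f t = g t) ->
  bounded_variation a b f -> bounded_variation a b g.
Proof.
rewrite le_eqVlt => /predU1P[<- _ _|ab fg bf]; first exact: bounded_variationxx.
have -> : g = f \+ (g \- f) by apply/funext => t /=; rewrite addrC subrK.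
apply: bounded_variationD => //; apply: nondecreasing_bounded_variation.
by move=> s t; rewrite !in_itv/= => sab tab _; rewrite !fg// !subrr.
Qed.

Section start_at_zero.
Context {R : realType}.
Variable f : cumulative R R.
Hypothesis f0 : forall t, t < 0 -> f t = 0.

Lemma lebesgue_stieltjes_negative :
  (lebesgue_stieltjes_measure f).-negligible [set t | t < 0].
Proof.
apply: negligible_right_open => [x /= x0|x q xq xq0].
  by exists 0 => // y; rewrite /= in_itv/= => /andP[].
have q0 : q < 0 by apply: xq0; rewrite /= in_itv/= xq lexx.
apply: lebesgue_stieltjes_cc_eq0 => // e e0; exists (x - 1); first lra.
by rewrite !f0 ?subrr ?ltW//; lra.
Qed.

(** Negative times carry no mass, so the complementarity integral over [[0, +oo[] controls all of
    [A]. *)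
Lemma lebesgue_stieltjes_null_set (A B : set R) : measurable A ->
  (\int[lebesgue_stieltjes_measure f]_(s in `[0%R, +oo[) (\1_B s)%:E = 0)%E ->
  (forall s, 0 <= s -> A s -> B s) ->
  lebesgue_stieltjes_measure f A = 0%E.
Proof.
move=> mA B0 AB.
have mD := measurable_itv `[0%R, +oo[ : measurable (`[(0 : R), +oo[%classic).
have AD0 : lebesgue_stieltjes_measure f (A `&` `[0%R, +oo[) = 0%E.
  apply: (integral_indic_eq0 mD _ B0); first exact: measurableI.
  by move=> s [As s0]; split=> //; apply: AB => //; move: s0; rewrite /= in_itv/= andbT.
have : (lebesgue_stieltjes_measure f).-negligible A.
  have : (lebesgue_stieltjes_measure f).-negligible
      ((A `&` `[0%R, +oo[) `|` [set t | t < 0]).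
    apply: negligibleU; last exact: lebesgue_stieltjes_negative.
    by apply/negligibleP => //; exact: measurableI.
  apply: negligibleS => s As; have [s0|s0] := ltP s 0; [by right|left].
  by split => //=; rewrite in_itv/= s0.
by move/negligibleP; apply.
Qed.

End start_at_zero.

(** * Existence and uniqueness for the Skorokhod problem *)

Theorem theorem2p9 (R : realType) (Lf Rf : R -> R -> R) (c C : R) (S : R -> R)
  (L_cadlag : forall x, cadlag (Lf ^~ x))
  (R_cadlag : forall x, cadlag (Rf ^~ x))
  (L_incr : forall t : R, 0 <= t -> {homo Lf t : x y / x < y})
  (R_incr : forall t : R, 0 <= t -> {homo Rf t : x y / x < y})
  (c_gt0 : 0 < c) (c_lt_C : c < C)
  (L_bilip : forall t x y : R, 0 <= t ->
     c * `|x - y| <= `|Lf t x - Lf t y| <= C * `|x - y|)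
  (R_bilip : forall t x y : R, 0 <= t ->
     c * `|x - y| <= `|Rf t x - Rf t y| <= C * `|x - y|)
  (gap : (0 < ereal_inf [set (Rf tx.1 tx.2 - Lf tx.1 tx.2)%:E
                        | tx in `[0%R, +oo[ `*` [set: R]])%E)
  (S_cadlag : cadlag S) :
  [/\ forall t : R, 0 <= t -> exists! p, Lf t (S t + p) = 0,
      forall t : R, 0 <= t -> exists! p, Rf t (S t + p) = 0 &
      forall Phi Psi : R -> R,
        (forall t : R, 0 <= t -> Lf t (S t + Phi t) = 0) ->
        (forall t : R, 0 <= t -> Rf t (S t + Psi t) = 0) ->
        let K := reflection_term Phi Psi in
        let X := S \+ K in
        skorokhod_solution Lf Rf S X K /\
        forall X' K' : R -> R, skorokhod_solution Lf Rf S X' K' ->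
          forall t : R, 0 <= t -> X' t = X t /\ K' t = K t].
Proof.
have ndL t (t0 : 0 <= t) : {homo Lf t : x y / x <= y} := ltW_homo (L_incr t t0).
have ndR t (t0 : 0 <= t) : {homo Rf t : x y / x <= y} := ltW_homo (R_incr t t0).
have incL t (t0 : 0 <= t) := le_mono (L_incr t t0).
have incR t (t0 : 0 <= t) := le_mono (R_incr t t0).
have uniq_root (f : R -> R) (x : R) : {mono f : x y / x <= y} ->
    (exists r, f r = 0) -> exists! p, f (x + p) = 0.
  move=> mf [r fr]; exists (r - x); split; first by rewrite addrC subrK.
  move=> p fp; have : x + p = r by apply: (inc_inj mf); rewrite fp fr.
  by move<-; rewrite addrC addKr.
split=> [t t0|t t0|Phi Psi LPhi RPsi K X].
- apply: uniq_root; first exact: incL.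
  by apply: (bilipschitz_root c_gt0 c_lt_C (ndL t t0)) => x y; exact: L_bilip.
- apply: uniq_root; first exact: incR.
  by apply: (bilipschitz_root c_gt0 c_lt_C (ndR t t0)) => x y; exact: R_bilip.
have cB (rho P : R -> R) : cadlag rho -> (forall t, 0 <= t -> rho t = S t + P t) ->
    cadlag P.
  move=> crho rhoE; apply: (cadlag_eq (f := rho \+ (\- S))).
    by move=> t t0 /=; rewrite rhoE// addrAC subrr add0r.
  exact: cadlagD crho (cadlagN S_cadlag).
have cPhi : cadlag Phi.
  apply: (cB (fun t => S t + Phi t)) => //.
  exact: (cadlag_root c_gt0 c_lt_C L_cadlag ndL L_bilip).
have cPsi : cadlag Psi.
  apply: (cB (fun t => S t + Psi t)) => //.
  exact: (cadlag_root c_gt0 c_lt_C R_cadlag ndR R_bilip).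
have [dl dl0 Hdl] : exists2 dl : R, 0 < dl & forall t x, 0 <= t -> dl <= Rf t x - Lf t x.
  set I := ereal_inf _ in gap.
  have HI t x : 0 <= t -> (I <= (Rf t x - Lf t x)%:E)%E.
    move=> t0; apply: ereal_inf_lbound; exists (t, x) => //.
    by split => //=; rewrite in_itv/= t0.
  have If : I \is a fin_num.
    rewrite ge0_fin_numE ?ltW//; apply: le_lt_trans (HI 0 0 (lexx _)) (ltry _).
  exists (fine I); first by rewrite -lte_fin fineK.
  by move=> t x t0; rewrite -lee_fin fineK// HI.
have C0 : 0 < C by lra.
(* At the root [S + Phi] of [Lf] the value of [Rf] is at least [dl]; since [Rf] is [C]-Lipschitz in
   space and vanishes at [S + Psi], the roots are at least [dl / C] apart. *)
pose d := dl / C; have d0 : 0 < d by rewrite divr_gt0.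
have Psi_Phi t : 0 <= t -> Psi t + d <= Phi t.
  move=> t0; have := Hdl t (S t + Phi t) t0; rewrite LPhi// subr0 => le_dl.
  have lt_Psi : S t + Psi t <= S t + Phi t by rewrite -(incR t t0) RPsi//; lra.
  have /andP[_] := R_bilip t (S t + Phi t) (S t + Psi t) t0.
  rewrite RPsi// subr0 !ger0_norm; [|by rewrite subr_ge0|lra].
  move=> /(le_trans le_dl); rewrite mulrC -ler_pdivrMr// -/d; lra.
pose lo t := if t < 0 then - d else - Phi t.
pose up t := if t < 0 then d else - Psi t.
pose h t := if t < 0 then 0 else - K t.
have rh : reflected lo up h := reflection_term_reflected d0 Psi_Phi cPsi.
have lo_up t : lo t + d <= up t.
  rewrite /lo /up; case: ltP => [_|t0]; first by rewrite addNr ltW.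
  by have := Psi_Phi t t0; lra.
have rlo : regulated lo := cadlag_regulated _ (cadlagN cPhi).
have rup : regulated up := cadlag_regulated _ (cadlagN cPsi).
have lopos t : 0 <= t -> lo t = - Phi t by rewrite /lo ltNge => ->.
have uppos t : 0 <= t -> up t = - Psi t by rewrite /up ltNge => ->.
have hpos t : 0 <= t -> h t = - K t by rewrite /h ltNge => ->.
have hneg t : t < 0 -> h t = 0 by rewrite /h => ->.
(* Monotonicity in space turns conditions on [Lf] and [Rf] into comparisons of the pushing term with
   [Phi] and [Psi]. *)
have L_le t k : 0 <= t -> (Lf t (S t + k) <= 0) = (k <= Phi t).
  by move=> t0; rewrite -(LPhi t t0) (incL t t0) lerD2l.
have R_ge t k : 0 <= t -> (0 <= Rf t (S t + k)) = (Psi t <= k).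
  by move=> t0; rewrite -(RPsi t t0) (incR t t0) lerD2l.
have L_lt t k : 0 <= t -> (Lf t (S t + k) < 0) = (k < Phi t).
  by move=> t0; rewrite -(LPhi t t0) (leW_mono (incL t t0)) ltrD2l.
have R_gt t k : 0 <= t -> (0 < Rf t (S t + k)) = (Psi t < k).
  by move=> t0; rewrite -(RPsi t t0) (leW_mono (incR t t0)) ltrD2l.
have mD := measurable_itv `[0%R, +oo[ : measurable (`[(0 : R), +oo[%classic).
split.
  have cK : cadlag K.
    apply: (cadlag_eq (f := \- h)); first by move=> t t0; rewrite /= hpos// opprK.
    exact/cadlagN/regulated_cadlag/(reflected_regulated d0 lo_up rlo rup rh).
  split.
  - exact: cadlagD.
  - split=> // a b a0 ab; apply: (eq_bounded_variation (f := \- h)) => //.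
      by move=> t tab; rewrite /= hpos ?opprK//; lra.
    exact/bounded_variationN/(reflected_bounded_variation d0 lo_up).
  - by [].
  - move=> t t0; rewrite /X /= L_le// R_ge//.
    by have [/(_ t) + _ _] := rh; rewrite lopos// uppos// hpos//; lra.
  (* [Kr] collects the descents of [h] and [Kl] its ascents, the latter as descents of [\- h] with
     the barriers exchanged; their difference is [- h = K]. *)
  have [Kr [Kr0 KrE Kr_null]] := reflected_compensator d0 lo_up rlo rup rh hneg.
  have nlo_up t : (\- up) t + d <= (\- lo) t by have := lo_up t; rewrite /=; lra.
  have hnegN t : t < 0 -> (\- h) t = 0 by move=> t0; rewrite /= hneg ?oppr0.
  have [Kl [Kl0 KlE Kl_null]] := reflected_compensator d0 nlo_up
    (regulatedN rup) (regulatedN rlo) (reflectedN rh) hnegN.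
  exists Kr, Kl; split=> [t t0|t t0||]; first by rewrite Kr0// Kl0.
  - by rewrite KrE// KlE// total_variationN /= hpos//; lra.
  - apply: (integral_indic_negligible mD Kl_null) => s [].
    rewrite /= in_itv/= andbT => s0; rewrite /X /= L_lt// => KPhi.
    by rewrite ltrN2 lopos// hpos// ltrN2.
  - apply: (integral_indic_negligible mD Kr_null) => s [].
    rewrite /= in_itv/= andbT => s0; rewrite /X /= R_gt// => PsiK.
    by rewrite uppos// hpos// ltrN2.
move=> X' K' [_ _ X'E LR [Kr [Kl [Krl0 K'E Kl_null Kr_null]]]].
have Kr0 t : t < 0 -> Kr t = 0 by move=> /Krl0[].
have Kl0 t : t < 0 -> Kl t = 0 by move=> /Krl0[].
(* For an arbitrary solution, [g] extends [- K'] by 0 to negative times, and complementarity makes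
   it reflected between the same barriers. *)
pose g t := Kl t - Kr t.
have gpos t : 0 <= t -> g t = - K' t by move=> t0; rewrite /g K'E// opprB.
have rg : reflected lo up g.
  split=> [t|u t m ut um lom|u t m ut um upm].
  - have [tlt0|t0] := ltP t 0.
      by rewrite /lo /up /g tlt0 Kr0// Kl0// subrr oppr_le0 (ltW d0).
    have := LR t t0; rewrite X'E// L_le// R_ge// lopos// uppos// gpos//; lra.
  - apply: (@cumulative_sub_le _ Kl Kr lo _ u t m ut um lom) => A mA Alo.
    apply: (lebesgue_stieltjes_null_set Kl0 mA Kl_null) => s s0 /Alo /=.
    by rewrite X'E// L_lt// lopos// -/(g s) gpos// ltrN2.
  - rewrite -lerN2 opprB.
    apply: (@cumulative_sub_le _ Kr Kl (\- up) _ u t (- m) ut).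
    + move=> A mA Aup; apply: (lebesgue_stieltjes_null_set Kr0 mA Kr_null).
      move=> s s0 /Aup /=.
      by rewrite X'E// R_gt// uppos// opprK -[_ - _]opprB -/(g s) gpos// opprK.
    + by move: um; rewrite /g; lra.
    + by move=> s /upm /=; rewrite lerN2.
move=> t t0; have K'K : K' t = K t.
  apply: oppr_inj; rewrite -gpos// -hpos//.
  (* Both paths vanish at -1, so their agreement at time 0 is part of the same uniqueness
     statement. *)
  apply: (reflected_unique d0 lo_up rlo rup (a := -1)) => //; last lra.
  by rewrite hneg ?ltrN10// /g Kl0 ?Kr0 ?subrr// ltrN10.
by rewrite X'E// K'K.
Qed.
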